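(* Let $G$ be an operator system and $\Omega=(\Omega_n)_{n\ge1}$ an open fully matricial $G$-set. If $r=(r_n)_{n\ge1}\in A(\Omega)$, $s=(s_n)_{n\ge1}\in A(\Omega)$ and $g'\in\Omega_m$, $g''\in\Omega_n$, then $$(\partial_{m,n}(rs)_{m+n})(g',g'')=(r_m(g')\otimes I_n)(\partial_{m,n}s_{m+n})(g',g'')+(\partial_{m,n}r_{m+n})(g',g'')(I_m\otimes s_n(g'')).$$
   Context: $\mathfrak{M}_n$ denotes the $n\times n$ complex matrices and $\mathfrak{M}_{m,n}$ the $m\times n$ complex matrices; $\mathfrak{M}_n(G)=\mathfrak{M}_n\otimes G$, and similarly $\mathfrak{M}_{m,n}(G)$. $G$ is an operator system (a unital selfadjoint space of Hilbert space operators, with unit $1$). For $S\in GL(n;\mathbb{C})$, $(\mathrm{Ad}S)(T)=STS^{-1}$, and $(\mathrm{Ad}S\otimes I_G)(T\otimes g)=STS^{-1}\otimes g$; $a\oplus b$ is the block diagonal matrix. A fully matricial $G$-set is a sequence $\Omega=(\Omega_n)_{n\ge1}$ with $\Omega_n\subset\mathfrak{M}_n(G)$, $\Omega_{m+n}\cap(\mathfrak{M}_m(G)\oplus\mathfrak{M}_n(G))=\Omega_m\oplus\Omega_n$, and $(\mathrm{Ad}S\otimes I_G)(\Omega_n)=\Omega_n$ for all $S\in GL(n;\mathbb{C})$. It is open if each $\Omega_n$ is open. $A(\Omega)$ is the set of scalar fully matricial analytic functions on $\Omega$: sequences $r=(r_n)_{n\ge1}$ of analytic functions $r_n:\Omega_n\to\mathfrak{M}_n$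 with $r_{m+n}(g'\oplus g'')=r_m(g')\oplus r_n(g'')$ for $g'\in\Omega_m,g''\in\Omega_n$, and $r_n((\mathrm{Ad}S\otimes I_G)(g))=(\mathrm{Ad}S)(r_n(g))$ for $S\in GL(n;\mathbb{C})$, $g\in\Omega_n$. It is an algebra with pointwise operations: $rs=(r_ns_n)_{n\ge1}$. $A_n(\Omega_n)$ is the algebra of analytic maps $f:\Omega_n\to\mathfrak{M}_n$ with $f((\mathrm{Ad}S\otimes I_G)(g))=(\mathrm{Ad}S)f(g)$ for $S\in GL(n;\mathbb{C})$. For $f\in A_{m+n}(\Omega_{m+n})$, $g'\in\Omega_m$, $g''\in\Omega_n$, $$(\partial_{m,n}f)(g',g'')=\sum_{1\le i,j\le m}\ \sum_{1\le k,l\le n}\Bigl(\tfrac{d}{d\varepsilon}f(g'\oplus g''+\varepsilon e_{j,k+m}\otimes1)\big|_{\varepsilon=0}\Bigr)_{i,m+l}\,e^{(m)}_{ij}\otimes e^{(n)}_{kl}\in\mathfrak{M}_m\otimes\mathfrak{M}_n,$$ where $(\cdot)_{i,m+l}$ is the $(i,m+l)$ entry of an $(m+n)\times(m+n)$ matrix, $e_{j,k+m}$ is a matrix unit in $\mathfrak{M}_{m+n}$, and $e^{(m)}_{ij},e^{(n)}_{kl}$ are the matrix units of $\mathfrak{M}_m,\mathfrak{M}_n$. *)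

(* Defs.v *)
From HB Require Import structures.
From mathcomp Require Import all_boot all_order all_algebra.
From mathcomp Require Import complex mxtens.
From mathcomp Require Import boolp classical_sets reals topology normedtype derive.

Set Implicit Arguments.
Unset Strict Implicit.
Unset Printing Implicit Defensive.

Import Order.TTheory GRing.Theory Num.Theory.
Import numFieldNormedType.Exports.

Local Open Scope classical_set_scope.
Local Open Scope ring_scope.
Local Open Scope complex_scope.

Record hilbertSpace (R : realType) := HilbertSpace {
  hilbert_sort :> completeNormedModType R[i];
  hdot : {dot hilbert_sort for Num.conj};
  hdotE : forall x : hilbert_sort, hdot x x = `|x| ^+ 2 }.

Definition is_opnorm (K : numDomainType) (V W : normedModType K)
    (T : V -> W) (c : K) : Prop :=
  [/\ 0 <= c, forall x, `|T x| <= c * `|x|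
    & forall b : K, 0 <= b -> (forall x, `|T x| <= b * `|x|) -> c <= b].

(* A space of operators on a Hilbert space is given by a normed space together
   with a linear map [os_op] into the operators on the Hilbert space that is
   isometric for the operator norm; the space of operators is the range of
   [os_op].  In particular every [os_op g] is bounded. *)
Record operatorSystem (R : realType) := OperatorSystem {
  os_hilbert : hilbertSpace R;
  os_sort :> normedModType R[i];
  os_op : os_sort -> {linear os_hilbert -> os_hilbert};
  os_op_linear : forall (a : R[i]) (g h : os_sort) (x : os_hilbert),
    os_op (a *: g + h) x = a *: os_op g x + os_op h x;
  os_op_norm : forall g : os_sort, is_opnorm (os_op g) `|g|;
  os_one : os_sort;
  os_op_one : forall x : os_hilbert, os_op os_one x = x;
  os_adjoint : forall g : os_sort, exists h : os_sort,
    forall x y : os_hilbert,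
      hdot os_hilbert (os_op g x) y = hdot os_hilbert x (os_op h y) }.

(* Only the topology of $\mathfrak{M}_n(V)$ matters below.  It is given by the
   sum of the norms of the entries; for V a space of operators on a Hilbert
   space H this norm is equivalent to the operator norm on H^n, since
   max_ij |g_ij| <= |g| <= sum_ij |g_ij|. *)
Section SquareMatricesOverNormedModule.
Variables (K : numFieldType) (V : normedModType K) (n : nat).

Definition sqmx : Type := 'M[V]_n.

HB.instance Definition _ := GRing.Zmodule.on sqmx.

Implicit Types (a b : K) (g h : sqmx).

Definition sqmx_scale a g : sqmx := \matrix_(i, j) (a *: g i j).

Lemma sqmx_scaleA a b g : sqmx_scale a (sqmx_scale b g) = sqmx_scale (a * b) g.
Proof. by apply/matrixP => i j; rewrite !mxE scalerA. Qed.

Lemma sqmx_scale1 : left_id 1 sqmx_scale.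
Proof. by move=> g; apply/matrixP => i j; rewrite !mxE scale1r. Qed.

Lemma sqmx_scaleDr : right_distributive sqmx_scale +%R.
Proof. by move=> a g h; apply/matrixP => i j; rewrite !mxE scalerDr. Qed.

Lemma sqmx_scaleDl g : {morph sqmx_scale^~ g : a b / a + b}.
Proof. by move=> a b; apply/matrixP => i j; rewrite !mxE scalerDl. Qed.

HB.instance Definition _ := GRing.Zmodule_isLmodule.Build K sqmx
  sqmx_scaleA sqmx_scale1 sqmx_scaleDr sqmx_scaleDl.

Definition sqmx_norm g : K := \sum_i \sum_j `|g i j|.

Lemma ler_sqmx_normD g h : sqmx_norm (g + h) <= sqmx_norm g + sqmx_norm h.
Proof.
rewrite -big_split; apply: ler_sum => i _; rewrite -big_split.
by apply: ler_sum => j _; rewrite mxE ler_normD.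
Qed.

Lemma sqmx_normZ a g : sqmx_norm (a *: g) = `|a| * sqmx_norm g.
Proof.
rewrite mulr_sumr; apply: eq_bigr => i _; rewrite mulr_sumr.
by apply: eq_bigr => j _; rewrite mxE normrZ.
Qed.

Lemma sqmx_norm_eq0 g : sqmx_norm g = 0 -> g = 0.
Proof.
move=> g0; apply/matrixP => i j; rewrite mxE; apply: normr0_eq0.
have g0i : \sum_j `|g i j| = 0.
  apply: (psumr_eq0P _ g0) => // k _; exact: sumr_ge0.
by apply: (psumr_eq0P _ g0i).
Qed.

HB.instance Definition _ := Lmodule_isNormed.Build K sqmx
  ler_sqmx_normD sqmx_normZ sqmx_norm_eq0.

End SquareMatricesOverNormedModule.

Section FullyMatricial.
Variables (R : realType) (G : operatorSystem R).
Local Notation C := R[i].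

Definition tens_mx n (T : 'M[C]_n) (g : G) : sqmx G n :=
  \matrix_(i, j) (T i j *: g).

Definition Ad_tens n (S : 'M[C]_n) (g : sqmx G n) : sqmx G n :=
  \matrix_(i, j) \sum_k \sum_l (S i k * invmx S l j) *: g k l.

Lemma Ad_tens_tens n (S T : 'M[C]_n) (g : G) :
  Ad_tens S (tens_mx T g) = tens_mx (S *m T *m invmx S) g.
Proof.
apply/matrixP => i j; rewrite !mxE scaler_suml exchange_big.
apply: eq_bigr => l _; rewrite mxE mulr_suml scaler_suml.
by apply: eq_bigr => k _; rewrite mxE scalerA mulrAC.
Qed.

Definition dsum_mx m n (g : sqmx G m) (h : sqmx G n) : sqmx G (m + n) :=
  block_mx g 0 0 h.

(* Sequences indexed by n >= 1 are indexed by all n; the term at n = 0 is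
   unconstrained. *)
Definition fully_matricial_set (Omega : forall n, set (sqmx G n)) : Prop :=
  (forall m n, (0 < m)%N -> (0 < n)%N ->
     Omega (m + n)%N `&` [set dsum_mx g h | g in setT & h in setT]
     = [set dsum_mx g h | g in Omega m & h in Omega n]) /\
  (forall n, (0 < n)%N -> forall S : 'M[C]_n, S \in unitmx ->
     Ad_tens S @` Omega n = Omega n).

Definition open_fully_matricial_set (Omega : forall n, set (sqmx G n)) : Prop :=
  fully_matricial_set Omega /\ (forall n, (0 < n)%N -> open (Omega n)).

(* Analyticity on an open subset of a complex normed space is complex Frechet
   differentiability at each of its points.  Functions on Omega n are total
   functions whose values outside Omega n are irrelevant. *)
Definition fully_matricial_analytic (Omega : forall n, set (sqmx G n))
    (r : forall n, sqmx G n -> 'M[C]_n) : Prop :=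
  [/\ forall n, (0 < n)%N -> forall g, Omega n g -> differentiable (r n) g,
      forall m n, (0 < m)%N -> (0 < n)%N ->
        forall g h, Omega m g -> Omega n h ->
          r (m + n)%N (dsum_mx g h) = block_mx (r m g) 0 0 (r n h)
    & forall n, (0 < n)%N -> forall S : 'M[C]_n, S \in unitmx ->
        forall g, Omega n g -> r n (Ad_tens S g) = S *m r n g *m invmx S].

Definition fm_mul (r s : forall n, sqmx G n -> 'M[C]_n) :
    forall n, sqmx G n -> 'M[C]_n :=
  fun n g => r n g *m s n g.

(* $\mathfrak{M}_m \otimes \mathfrak{M}_n$ is identified with 'M_(m * n) by the
   Kronecker product [*t]. *)
Definition partial_mx m n (f : sqmx G (m + n) -> 'M[C]_(m + n))
    (g : sqmx G m) (h : sqmx G n) : 'M[C]_(m * n) :=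
  \sum_(i < m) \sum_(j < m) \sum_(k < n) \sum_(l < n)
    (derive1 (fun e : C => f (dsum_mx g h +
        e *: tens_mx (delta_mx (lshift n j) (rshift m k)) (os_one G))) 0)
      (lshift n i) (rshift m l)
    *: (delta_mx i j *t delta_mx k l).

End FullyMatricial.

Arguments fm_mul {R G} r s n g.

(* Main.v *)
(* At the block-diagonal point g' (+) g'' the values of r and s are block
   diagonal, so in the product rule d(r s) = dr s + r ds the upper-right block
   of dr s only sees s_n(g'') and that of r ds only sees r_m(g').  The entry of
   [partial_mx f] at row (i, k) and column (j, l) is the (i, m + l) entry of the
   derivative of f in the direction e_{j,k+m}; hence left multiplication of
   blocks by r_m(g') becomes r_m(g') (x) I_n, and right multiplication by
   s_n(g'') becomes I_m (x) s_n(g''). *)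
From HB Require Import structures.
Require Import Defs.
From mathcomp Require Import all_boot all_order all_algebra.
From mathcomp Require Import complex mxtens.
From mathcomp Require Import boolp classical_sets functions reals topology normedtype derive.

Import GRing.Theory.
Import numFieldNormedType.Exports.

Local Open Scope ring_scope.
Local Open Scope complex_scope.

(* [derivable_mxP] and [derive_mx] of MathComp-Analysis require a real field;
   these are the versions needed over the complex numbers. *)
Section MatrixDerivative.
Context {K : numFieldType} {V : normedModType K}.

(** Entries are differentiable coordinate functions. Conversely, a matrix function is the finite sum
    of its entries times the constant matrices [delta_mx i j]. *)
Lemma differentiable_mxP m n (M : V -> 'M[K]_(m, n)) x :
  differentiable M x <->
  forall i j, differentiable (fun y => M y i j : K) x.
Proof.
split=> [dM i j|dM].
  apply: (@differentiable_comp _ _ _ _ M (fun A : 'M[K]_(m, n) => A i j : K)) => //.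
  exact: differentiable_coord.
have -> : M = \sum_i \sum_j (fun y => M y i j *: delta_mx i j).
  apply/funext => y; rewrite fct_sumE [LHS]matrix_sum_delta.
  by apply: eq_bigr => i _; rewrite fct_sumE.
apply: differentiable_sum => i; apply: differentiable_sum => j.
exact: differentiableZl.
Qed.

(** Taking an entry is a continuous linear map, hence its own differential, so the chain rule moves
    it through the derivative. *)
Lemma derive_coord m n (M : V -> 'M[K]_(m, n)) x v i j :
  differentiable M x -> 'D_v M x i j = 'D_v (fun y => M y i j : K) x.
Proof.
move=> dM.
pose c (A : 'M[K]_(m, n)) : K := A i j.
have lc : linear c by move=> a A B; rewrite /c !mxE.
(* The entry map is bundled as linear into [K^o], the scalars seen as a normed module, so that
   differentials of linear maps apply to it. *)
pose c' : {linear 'M[K]_(m, n) -> K^o} :=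
  HB.pack c (GRing.isLinear.Build _ _ _ _ c lc).
have cc : continuous c' by exact: coord_continuous.
have dc : differentiable c' (M x) by exact: linear_differentiable.
rewrite [RHS](@deriveE _ _ _ (c' \o M)); last exact: differentiable_comp.
rewrite diff_comp //= deriveE //.
by have /(congr1 (fun f => f ('d M x v))) -> := diff_lin (M x) cc.
Qed.

Lemma differentiable_mulmx m n p (A : V -> 'M[K]_(m, n)) (B : V -> 'M[K]_(n, p)) x :
  differentiable A x -> differentiable B x ->
  differentiable (fun y => A y *m B y) x.
Proof.
move=> /differentiable_mxP dA /differentiable_mxP dB.
apply/differentiable_mxP => i j.
have -> : (fun y => (A y *m B y) i j) = \sum_k (fun y => A y i k * B y k j).
  by apply/funext => y; rewrite mxE fct_sumE.
by apply: differentiable_sum => k; exact: differentiableM.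
Qed.

Lemma derive_mulmx m n p (A : V -> 'M[K]_(m, n)) (B : V -> 'M[K]_(n, p)) x v :
  differentiable A x -> differentiable B x ->
  'D_v (fun y => A y *m B y) x = 'D_v A x *m B x + A x *m 'D_v B x.
Proof.
move=> dA dB; apply/matrixP => i j.
rewrite derive_coord; last exact: differentiable_mulmx.
have -> : (fun y => (A y *m B y) i j) = \sum_k (fun y => A y i k * B y k j).
  by apply/funext => y; rewrite mxE fct_sumE.
have dAij i' k : differentiable (fun y => A y i' k : K) x.
  by move/differentiable_mxP: dA.
have dBij k j' : differentiable (fun y => B y k j' : K) x.
  by move/differentiable_mxP: dB.
rewrite derive_sum => [|k]; last exact/diff_derivable/differentiableM.
rewrite !mxE -big_split; apply: eq_bigr => k _ /=.
(* The scalar rule scales each derivative on the left by the other factor; commutativity of [K]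
   restores the matrix order. *)
rewrite deriveM; try exact: diff_derivable.
by rewrite !derive_coord // addrC; congr (_ + _); rewrite [LHS]mulrC.
Qed.

(** The two difference quotients already agree as functions, before any limit is taken. *)
Lemma derive1_line (W : normedModType K) (f : V -> W) x v :
  derive1 (fun e : K => f (x + e *: v)) 0 = 'D_v f x.
Proof.
rewrite /derive1 /derive; set p := fun _ => _; set q := fun _ => _.
suff -> : p = q by [].
by apply/funext => e; rewrite /p /q /= addr0 scale0r addr0 [x + _]addrC.
Qed.

End MatrixDerivative.

Section TensorEntries.
Context {K : comPzRingType}.

Lemma big_mxtens_index m n (F : 'I_(m * n) -> K) :
  \sum_p F p = \sum_i \sum_k F (mxtens_index (i, k)).
Proof.
rewrite pair_bigA /= (reindex (@mxtens_index m n)) /=.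
  by apply: eq_bigr => -[].
by exists (@mxtens_unindex m n) => p _; [exact: mxtens_indexK|exact: mxtens_unindexK].
Qed.

(** The identity factor forces the second tensor index to stay [k], so [A] acts on the first index
    alone. *)
Lemma tensmx1_mulE m n q (A : 'M[K]_m) (P : 'M[K]_(m * n, q)) i k c :
  ((A *t (1%:M : 'M_n)) *m P) (mxtens_index (i, k)) c =
  \sum_p A i p * P (mxtens_index (p, k)) c.
Proof.
rewrite mxE big_mxtens_index; apply: eq_bigr => p _.
rewrite (bigD1 k) //= big1 ?addr0 => [|k' k'k]; rewrite tensmxE mxE.
  by rewrite eqxx mulr1.
by rewrite eq_sym (negPf k'k) mulr0 mul0r.
Qed.

Lemma mul_tens1mxE m n q (B : 'M[K]_n) (P : 'M[K]_(q, m * n)) c j l :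
  (P *m ((1%:M : 'M_m) *t B)) c (mxtens_index (j, l)) =
  \sum_p P c (mxtens_index (j, p)) * B p l.
Proof.
rewrite mxE big_mxtens_index (bigD1 j) //= [X in _ + X]big1 ?addr0.
  by apply: eq_bigr => p _; rewrite tensmxE mxE eqxx mul1r.
move=> j' j'j; rewrite big1 // => p _.
by rewrite tensmxE mxE (negPf j'j) mul0r mulr0.
Qed.

(** Tensors of matrix units are the matrix units of the Kronecker product, so a single term
    survives; the four indices are fixed one after another. *)
Lemma sum_delta_tensE m n (F : 'I_m -> 'I_m -> 'I_n -> 'I_n -> K) i j k l :
  (\sum_i' \sum_j' \sum_k' \sum_l'
     F i' j' k' l' *: (delta_mx i' j' *t delta_mx k' l'))
    (mxtens_index (i, k)) (mxtens_index (j, l)) = F i j k l.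
Proof.
have E i' j' k' l' :
    (F i' j' k' l' *: (delta_mx i' j' *t delta_mx k' l' : 'M[K]_(m * n)))
      (mxtens_index (i, k)) (mxtens_index (j, l)) =
    F i' j' k' l' * (((i == i') && (j == j'))%:R * ((k == k') && (l == l'))%:R).
  by rewrite mxE tensmxE !mxE.
rewrite summxE (bigD1 i) //= [X in _ + X]big1 ?addr0 => [|i' i'i]; last first.
  rewrite summxE big1 // => j' _; rewrite summxE big1 // => k' _.
  by rewrite summxE big1 // => l' _; rewrite E eq_sym (negPf i'i) mul0r mulr0.
rewrite summxE (bigD1 j) //= [X in _ + X]big1 ?addr0 => [|j' j'j]; last first.
  rewrite summxE big1 // => k' _; rewrite summxE big1 // => l' _.
  by rewrite E (eq_sym j) (negPf j'j) andbF mul0r mulr0.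
rewrite summxE (bigD1 k) //= [X in _ + X]big1 ?addr0 => [|k' k'k]; last first.
  rewrite summxE big1 // => l' _.
  by rewrite E (eq_sym k) (negPf k'k) !mulr0.
rewrite summxE (bigD1 l) //= [X in _ + X]big1 ?addr0 => [|l' l'l]; last first.
  by rewrite E (eq_sym l) (negPf l'l) andbF !mulr0.
by rewrite E !eqxx !mulr1.
Qed.

End TensorEntries.

Section Partial.
Context {R : realType} {G : operatorSystem R}.

Lemma partial_mxE m n (f : sqmx G (m + n) -> 'M[R[i]]_(m + n))
    (g : sqmx G m) (h : sqmx G n) i j k l :
  partial_mx f g h (mxtens_index (i, k)) (mxtens_index (j, l)) =
  'D_(tens_mx (delta_mx (lshift n j) (rshift m k)) (os_one G)) f (dsum_mx g h)
    (lshift n i) (rshift m l).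
Proof.
by rewrite /partial_mx sum_delta_tensE derive1_line.
Qed.

Lemma fully_matricial_dsum (Omega : forall n, set (sqmx G n)) m n
    (g : sqmx G m) (h : sqmx G n) :
  fully_matricial_set Omega -> (0 < m)%N -> (0 < n)%N ->
  Omega m g -> Omega n h -> Omega (m + n)%N (dsum_mx g h).
Proof.
move=> [Osum _] m0 n0 Og Oh.
have : [set dsum_mx a b | a in Omega m & b in Omega n]%classic (dsum_mx g h).
  by exists g => //; exists h.
by rewrite -Osum // => -[].
Qed.

End Partial.

Theorem corollary7p10 (R : realType) (G : operatorSystem R)
    (Omega : forall n : nat, set (sqmx G n))
    (hOmega : open_fully_matricial_set Omega)
    (r s : forall n : nat, sqmx G n -> 'M[R[i]]_n)
    (hr : fully_matricial_analytic Omega r)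
    (hs : fully_matricial_analytic Omega s)
    (m n : nat) (hm : (0 < m)%N) (hn : (0 < n)%N)
    (g' : sqmx G m) (g'' : sqmx G n)
    (hg' : Omega m g') (hg'' : Omega n g'') :
  partial_mx (fm_mul r s (m + n)%N) g' g'' =
    (r m g' *t 1%:M) *m partial_mx (s (m + n)%N) g' g'' +
    partial_mx (r (m + n)%N) g' g'' *m (1%:M *t s n g'').
Proof.
have Og : Omega (m + n)%N (dsum_mx g' g'').
  by apply: fully_matricial_dsum => //; case: hOmega.
have mn0 : (0 < m + n)%N by rewrite addn_gt0 hm.
case: hr hs => dr rsum _ [ds ssum _].
have {dr}dr := dr _ mn0 _ Og; have {ds}ds := ds _ mn0 _ Og.
apply/matrixP => a b.
case: (mxtens_indexP a) => i k; case: (mxtens_indexP b) => j l.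
rewrite partial_mxE [RHS]mxE tensmx1_mulE mul_tens1mxE.
under eq_bigr do rewrite partial_mxE.
under [X in _ = _ + X]eq_bigr do rewrite partial_mxE.
(* The swap puts the term with the derivative of [s] first, as on the right-hand side. *)
rewrite derive_mulmx // addrC rsum // ssum //.
rewrite 3!mxE !big_split_ord /=.
(* The zero upper-right block of the value of [r] removes the indices [rshift m p] here; that of [s]
   removes the indices [lshift n p] in the other sum. *)
rewrite [X in _ + X + _]big1 ?addr0 => [|p _]; last first.
  by rewrite block_mxEur mxE mul0r.
rewrite [X in _ + (X + _)]big1 ?add0r => [|p _]; last first.
  by rewrite block_mxEur mxE mulr0.
by congr (_ + _); apply: eq_bigr => p _; rewrite ?block_mxEul ?block_mxEdr.
Qed.
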